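(* For any $1\le k'\le k$, the output of any algorithm is at most an $O(\frac{k'}{k})$-approximate (non-randomized) composable core-set of size $k'$ for the monotone submodular maximization problem with cardinality constraint $k$.
   Context: For a finite ground set $\mathbb N$ and $f:2^{\mathbb N}\to\mathbb R_{\ge0}$, $f_k(S)=\max_{S'\subseteq S,|S'|\le k}f(S')$. An algorithm $\mathsf{ALG}$ that given any $T\subseteq\mathbb N$ returns $\mathsf{ALG}(T)\subseteq T$ with $|\mathsf{ALG}(T)|\le k'$ is an $\alpha$-approximate (non-randomized) composable core-set of size $k'$ for $f$ if for every arbitrary partition $\{T_1,\dots,T_m\}$ of $\mathbb N$, $f_k(\mathsf{ALG}(T_1)\cup\dots\cup\mathsf{ALG}(T_m))\ge\alpha f_k(T_1\cup\dots\cup T_m)$. The claim asserts that there are instances (monotone submodular $f$, with some partition) on which no algorithm achieves better than $O(k'/k)$ in this sense. *)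

(* Defs.v *)
From mathcomp Require Import all_boot all_order all_algebra.
From mathcomp Require Import reals.

Set Implicit Arguments.
Unset Strict Implicit.
Unset Printing Implicit Defensive.

Import Order.TTheory GRing.Theory Num.Theory.
Local Open Scope ring_scope.

Section Coresets.
Variables (R : realType) (N : finType).
Implicit Types (f : {set N} -> R) (ALG : {set N} -> {set N}).

Definition nonneg_setfun f := forall A : {set N}, 0 <= f A.

Definition monotone_setfun f :=
  forall A B : {set N}, A \subset B -> f A <= f B.

Definition submodular f :=
  forall A B : {set N}, f (A :|: B) + f (A :&: B) <= f A + f B.

(* [set0] is always feasible, so taking [f set0] as the neutral value of the
   iterated maximum does not change it, whatever the sign of [f]. *)
Definition fmax f (k : nat) (S : {set N}) : R :=
  \big[Num.max/f set0]_(A : {set N} | (A \subset S) && (#|A| <= k)%N) f A.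

(* Nothing is assumed on how the output is obtained: it may depend on [f]. *)
Definition selects_at_most (k' : nat) ALG :=
  forall T : {set N}, ALG T \subset T /\ (#|ALG T| <= k')%N.

Definition achieves_on (k : nat) f ALG (P : {set {set N}}) (alpha : R) : Prop :=
  alpha * fmax f k (cover P) <= fmax f k (\bigcup_(T in P) ALG T).

(* [partition] requires the parts to be nonempty. This loses nothing: an empty
   part can only contribute the empty set to either union. *)
Definition composable_coreset (k k' : nat) f ALG (alpha : R) : Prop :=
  selects_at_most k' ALG /\
  forall P : {set {set N}},
    partition P [set: N] -> achieves_on k f ALG P alpha.

End Coresets.

(* Main.v *)
Require Import Defs.
From mathcomp Require Import all_boot all_order all_algebra.
From mathcomp Require Import reals.

(* One part B of the partition has k elements, the other m - 1 parts are
   singletons, and f A = #|A :&: B|. The optimum is k, attained at B, whereas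
   every selection keeps at most k' elements of B. *)

Set Implicit Arguments.
Unset Strict Implicit.
Unset Printing Implicit Defensive.

Import Order.TTheory GRing.Theory Num.Theory.
Local Open Scope ring_scope.

Section Fibres.
Variables (X Y : finType) (g : X -> Y).

(** Presenting the partition through a map reduces counting its parts to counting the codomain. *)
Definition fibres : {set {set X}} := [set g @^-1: [set y] | y : Y].

Hypothesis g_surj : forall y, exists x, g x = y.

Lemma fibres_partition : partition fibres [set: X].
Proof.
apply/and3P; split.
- apply/eqP/setP=> x; rewrite in_setT; apply/bigcupP.
  by exists (g @^-1: [set g x]); rewrite ?imset_f // !inE.
- apply/trivIsetP=> _ _ /imsetP[y _ ->] /imsetP[z _ ->] neq_yz.
  rewrite -setI_eq0 -subset0; apply/subsetP=> x; rewrite !inE.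
  by case/andP=> /eqP gxy /eqP gxz; rewrite -gxy -gxz eqxx in neq_yz.
- apply/imsetP=> -[y _ /setP fib0].
  by have [x gx] := g_surj y; have := fib0 x; rewrite !inE gx eqxx.
Qed.

(** By surjectivity each fibre contains a point, and that point determines the label, so distinct
    labels give distinct fibres. *)
Lemma card_fibres : #|fibres| = #|Y|.
Proof.
apply: card_imset => y z /setP eq_yz.
by have [x gx] := g_surj y; have := eq_yz x; rewrite !inE gx eqxx => /esym/eqP.
Qed.

End Fibres.

Section CardInter.
Variables (R : realType) (N : finType) (B : {set N}).

Definition card_inter (A : {set N}) : R := #|A :&: B|%:R.

Lemma card_inter_nonneg : nonneg_setfun card_inter.
Proof. by move=> A; rewrite ler0n. Qed.

Lemma card_inter_monotone : monotone_setfun card_inter.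
Proof. by move=> A A' sAA'; rewrite ler_nat subset_leq_card ?setSI. Qed.

(** The function is in fact modular: intersecting with [B] distributes over unions and
    intersections, and inclusion-exclusion gives equality. *)
Lemma card_inter_submodular : submodular card_inter.
Proof.
move=> A A'; rewrite -!natrD ler_nat setIUl.
have -> : A :&: A' :&: B = (A :&: B) :&: (A' :&: B) by rewrite setIACA setIid.
by rewrite cardsUI.
Qed.

Lemma fmax_card_inter_ge k (S : {set N}) :
  B \subset S -> (#|B| <= k)%N -> #|B|%:R <= fmax card_inter k S.
Proof.
move=> sBS leBk; have {1}-> : #|B|%:R = card_inter B by rewrite /card_inter setIid.
by apply: (le_bigmax_cond _ card_inter); rewrite sBS.
Qed.

Lemma fmax_card_inter_le k (S : {set N}) :
  fmax card_inter k S <= #|S :&: B|%:R.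
Proof.
(* The first case is the default value at [set0]; the others follow by monotonicity, whatever the
   size of [A]. *)
apply: bigmax_le => [|A /andP[sAS _]]; first exact: card_inter_monotone (sub0set S).
exact: card_inter_monotone.
Qed.

(** Since [ALG T] stays inside [T] and the parts are disjoint, every selected point of [B] comes
    from [ALG B] alone. *)
Lemma card_selection_part k' (ALG : {set N} -> {set N}) (P : {set {set N}}) :
  trivIset P -> B \in P -> selects_at_most k' ALG ->
  (#|(\bigcup_(T in P) ALG T) :&: B| <= k')%N.
Proof.
move=> trivP PB selALG; apply: leq_trans (selALG B).2.
apply/subset_leq_card/subsetP=> x /setIP[/bigcupP[T PT ALGx] Bx].
have Tx := subsetP (selALG T).1 x ALGx.
by rewrite -(def_pblock trivP PB Bx) (def_pblock trivP PT Tx).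
Qed.

Lemma card_inter_approx k' (ALG : {set N} -> {set N}) (P : {set {set N}})
    (alpha : R) :
  partition P [set: N] -> B \in P -> (0 < #|B|)%N -> selects_at_most k' ALG ->
  achieves_on #|B| card_inter ALG P alpha -> alpha <= k'%:R / #|B|%:R.
Proof.
case/and3P=> /eqP covP trivP _ PB B_gt0 selALG; rewrite /achieves_on covP => ach.
(* Multiplying the lower bound on the optimum by [alpha] needs [alpha] nonnegative; otherwise the
   claim is immediate. *)
have [alpha_le0|/ltW alpha_ge0] := lerP alpha 0.
  by rewrite (le_trans alpha_le0) // divr_ge0.
rewrite ler_pdivlMr ?ltr0n //.
apply: le_trans (ler_wpM2l alpha_ge0 (fmax_card_inter_ge (subsetT B) (leqnn _))) _.
apply: le_trans ach (le_trans (fmax_card_inter_le _ _) _).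
by rewrite ler_nat card_selection_part.
Qed.

End CardInter.

Theorem theorem8 (R : realType) :
  exists C : R, 0 < C /\
  forall m k k' : nat, (1 <= m)%N -> (1 <= k')%N -> (k' <= k)%N ->
  exists (N : finType) (f : {set N} -> R) (P : {set {set N}}),
    [/\ nonneg_setfun f, monotone_setfun f & submodular f] /\
    (partition P [set: N] /\ #|P| = m) /\
    forall ALG : {set N} -> {set N}, selects_at_most k' ALG ->
      (forall alpha : R,
         achieves_on k f ALG P alpha -> alpha <= C * (k'%:R / k%:R)) /\
      (forall alpha : R,
         composable_coreset k k' f ALG alpha -> alpha <= C * (k'%:R / k%:R)).
Proof.
(* The bound holds with constant 1. From here [m] counts the singletons, so there are [m.+1]
   parts. *)
exists 1; split=> // -[//|m] k k' _ k'_gt0 le_k'k.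
have k_gt0 : (0 < k)%N by apply: leq_trans le_k'k.
(* The label [None] collects the [k] left points into [B]; each right point keeps its own label. *)
pose g (x : 'I_k + 'I_m) := if x is inr j then Some j else None.
have g_surj y : exists x, g x = y.
  by case: y => [j|]; [exists (inr j) | exists (inl (Ordinal k_gt0))].
pose B := g @^-1: [set None].
have cardB : #|B| = k.
  transitivity #|[set (inl i : 'I_k + 'I_m) | i : 'I_k]|; last first.
    by rewrite (card_imset _ inl_inj) card_ord.
  apply: eq_card => -[i|j]; rewrite !inE /=; apply/esym.
    exact: imset_f.
  by apply/imsetP=> -[].
have PB : B \in fibres g by apply: imset_f.
have partP := fibres_partition g_surj.
exists ('I_k + 'I_m)%type, (card_inter R B), (fibres g); split.
  by split; [apply: card_inter_nonneg | apply: card_inter_monotone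
            | apply: card_inter_submodular].
split; first by rewrite (card_fibres g_surj) card_option card_ord.
move=> ALG selALG.
(* This single partition suffices for both claims, as a composable core-set must achieve its ratio
   on every partition. *)
have bound alpha : achieves_on k (card_inter R B) ALG (fibres g) alpha ->
    alpha <= 1 * (k'%:R / k%:R).
  have := card_inter_approx (R := R) (alpha := alpha) partP PB _ selALG.
  by rewrite cardB mul1r; apply.
by split=> // alpha [_ ach]; apply/bound/ach.
Qed.
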